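(* Let $(\mathcal G,c)$ be either $(\mathcal G_d,c_d)$ or $(\mathcal G_u,c_u)$, and let $g:\mathcal D\setminus\mathcal B\to\mathbb{R}^{\ge 2}$ and $h:\mathcal D\setminus\mathcal B\to\mathbb{R}^{>0}$ be functions. Suppose that for all $(n,s,t)\in\mathcal D\setminus\mathcal B$ the following conditions hold: (1) for any $(G,S,T)\in\mathcal G$ with $(|G|,|S|,|T|)=(n,s,t)$, there exists an element $k\in G\setminus\{0_G\}$ accounting for at least $h(n,s,t)$ elements of $T$ with respect to $S$; (2) for every $(n',s',t')\in\mathcal D\setminus\mathcal B$ with $n'\le \frac n2$, $s'\le s$, $t'\le t$, either $g(n,s,t)\ge c(n',s',t')$ or $g(n,s,t)\ge g(n',s',t')$; (3) for every integer $t'$ with $1\le t'\le t-h(n,s,t)$, $g(n,s,t)\ge g(n,s,t')+1$. Then $c(n,s,t)\le g(n,s,t)$ for every $(n,s,t)\in\mathcal D\setminus\mathcal B$.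
   Context: $\mathcal G_d$ is the class of triples $(G,S,T)$ where $G$ is a finite abelian group (written additively), $S$ is a generating set of $G$ with $0_G\notin S$, and $T\subseteq S$. $\mathcal G_u$ is the subclass of those with $S=-S$. $\mathcal D=\{(n,s,t)\in\mathbb N^3: n\ge1,\ n-1\ge s\ge t\ge 0\}$ (with $0\in\mathbb N$), and $\mathcal B=\{(n,s,t)\in\mathcal D: t=0\text{ or }s=n-1\}$. An element $k\in G\setminus\{0_G\}$ accounts for $a\in S$ with respect to $S$ if there is $b\in S\cup\{0_G\}$ with $a-b=k$. $\mathrm{Cay}(G,S)$ is the digraph with vertex set $G$ and an arc from $u$ to $v$ iff $v-u\in S$. The game of cops and robbers on $\mathrm{Cay}(G,S)$ with robber moveset $T$: each cop chooses a starting vertex, then the robber does; then cop turns and robber turns alternate, starting with a cop turn. On a cop turn each cop at $x$ moves to $x+s$ for some $s\in S$, or stays. On a robber turn the robber at $r$ moves to $r+a$ for some $a\in T$, or stays. Full information; several cops may share a vertex. The cops win iff at some point a cop shares a vertex with the robber. For $(n,s,t)\in\mathcal D$, $c_d(n,s,t)$ (resp. $c_u(n,s,t)$) is the maximum, over all triples $(G,S,T)\in\mathcal G_d$ (resp. $\mathcal G_u$) with $(|G|,|S|,|T|)=(n,s,t)$, of the minimum number of cops having a winning strategy in the game on $\mathrm{Cay}(G,S)$ with robber moveset $T$; if there is no such triple, the value is defined to be $1$. *)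

(* Defs.v *)
From HB Require Import structures.
From mathcomp Require Import all_boot all_order all_algebra all_fingroup.
From mathcomp Require Import boolp reals.

Set Implicit Arguments.
Unset Strict Implicit.
Unset Printing Implicit Defensive.

Import Order.TTheory GRing.Theory Num.Theory.

Local Open Scope ring_scope.

(* <<S>> is the subgroup generated by S for the additive group structure that
   finalg puts on G. *)
Definition Gd (G : finZmodType) (S T : {set G}) : Prop :=
  [/\ <<S>>%g = [set: G], 0 \notin S & T \subset S].

Definition Gu (G : finZmodType) (S T : {set G}) : Prop :=
  Gd S T /\ S = [set - x | x in S].

Definition inD (n s t : nat) : bool :=
  [&& (1 <= n)%N, (s <= n - 1)%N & (t <= s)%N].

Definition inB (n s t : nat) : bool :=
  inD n s t && ((t == 0%N) || (s == n - 1)%N).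

Definition accounts (G : finZmodType) (S : {set G}) (k a : G) : bool :=
  [exists b in 0 |: S, a - b == k].

Definition Cay (G : finZmodType) (S : {set G}) : rel G :=
  fun u v => v - u \in S.

Definition step (G : finZmodType) (S : {set G}) : rel G :=
  fun u v => (v == u) || Cay S u v.

Definition robber_play (G : finZmodType) (T : {set G}) (r : nat -> G) : Prop :=
  forall i, step T (r i) (r i.+1).

(* A strategy maps the robber's positions r 0, ..., r (i - 1) so far to the
   positions of the m cops after i cop turns; its value at [::] is the cops'
   starting placement.  The cops' own past positions are determined by the
   strategy, so this is full information. *)
Definition strategy (G : finZmodType) (m : nat) := seq G -> {ffun 'I_m -> G}.

Definition legal_against (G : finZmodType) (S : {set G}) (m : nat)
    (sigma : strategy G m) (r : nat -> G) : Prop :=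
  forall (i : nat) (j : 'I_m),
    step S (sigma (mkseq r i) j) (sigma (mkseq r i.+1) j).

(* Capture is tested when the robber has just arrived at r i, and again after
   the next cop turn. *)
Definition captures (G : finZmodType) (m : nat)
    (sigma : strategy G m) (r : nat -> G) : Prop :=
  exists (i : nat) (j : 'I_m),
    sigma (mkseq r i) j = r i \/ sigma (mkseq r i.+1) j = r i.

Definition cops_win (G : finZmodType) (S T : {set G}) (m : nat) : Prop :=
  exists sigma : strategy G m, forall r : nat -> G, robber_play T r ->
    legal_against S sigma r /\ captures sigma r.

Lemma cops_win_card (G : finZmodType) (S T : {set G}) : cops_win S T #|G|.
Proof.
exists (fun=> [ffun j => enum_val j]) => r _; split.
  by move=> i j; rewrite /step eqxx.
by exists 0%N, (enum_rank (r 0%N)); left; rewrite ffunE enum_rankK.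
Qed.

Lemma cops_win_ex (G : finZmodType) (S T : {set G}) :
  exists m, `[< cops_win S T m >].
Proof. by exists #|G|; apply/asboolP; exact: cops_win_card. Qed.

Definition cop_number (G : finZmodType) (S T : {set G}) : nat :=
  ex_minn (cops_win_ex S T).

Lemma cop_number_le_card (G : finZmodType) (S T : {set G}) :
  (cop_number S T <= #|G|)%N.
Proof.
rewrite /cop_number; case: ex_minnP => m _; apply.
by apply/asboolP; exact: cops_win_card.
Qed.

Definition triple_class := forall G : finZmodType, {set G} -> {set G} -> Prop.

Definition attained (C : triple_class) (n s t k : nat) : Prop :=
  exists (G : finZmodType) (S T : {set G}),
    [/\ C G S T, #|G| = n, #|S| = s, #|T| = t & cop_number S T = k].

Lemma attained_le (C : triple_class) (n s t k : nat) :
  `[< attained C n s t k >] -> (k <= n)%N.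
Proof.
by move/asboolP => -[G [S [T [_ <- _ _ <-]]]]; exact: cop_number_le_card.
Qed.

Definition max_cop_number (C : triple_class) (n s t : nat) : nat :=
  match pselect (exists k, `[< attained C n s t k >]) with
  | left ex => ex_maxn ex (@attained_le C n s t)
  | right _ => 1%N
  end.

Definition cd : nat -> nat -> nat -> nat := max_cop_number Gd.
Definition cu : nat -> nat -> nat -> nat := max_cop_number Gu.

(* Main.v *)
From HB Require Import structures.
Require Import Defs.
From mathcomp Require Import all_boot all_order all_algebra all_fingroup.
From mathcomp Require Import boolp reals.

Set Implicit Arguments.
Unset Strict Implicit.
Unset Printing Implicit Defensive.

Import Order.TTheory GRing.Theory Num.Theory.

Local Open Scope ring_scope.

(* Let k account for many elements of T.  In G / <k> enough cops catch the
   image of the robber, so one cop reaches the robber's coset of <k>.  From then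
   on that cop mirrors the robber's moves, except that a move accounted for by k
   is answered so as to come one multiple of k closer.  Hence the robber can
   afford only finitely many accounted moves, and the remaining cops win against
   the smaller moveset of unaccounted ones.  Induction on |G|, then |T|. *)

(** * The game as an inductive forcing relation *)

(** The cops are indexed by any finite type, so that a subteam can be cut out by an injection. *)
Definition moves (G : finZmodType) (S : {set G}) (I : finType) :
    rel {ffun I -> G} :=
  fun c c' => [forall i, step S (c i) (c' i)].

(* The cops are to move at [(c, r)], but the goal [P] is tested after their
   move, with the robber to play. *)
Inductive force (G : finZmodType) (S T : {set G}) (I : finType)
    (P : {ffun I -> G} -> G -> Prop) (c : {ffun I -> G}) (r : G) : Prop :=
| force_now c' of moves S c c' & P c' r
| force_next c' of moves S c c' &
    (forall r', step T r r' -> force S T P c' r').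

Definition caught (G : finZmodType) (I : finType) (c : {ffun I -> G}) (r : G) :
  Prop := exists i, c i = r.

Lemma step_refl (G : finZmodType) (S : {set G}) : reflexive (step S).
Proof. by move=> x; rewrite /step eqxx. Qed.

Lemma stepE (G : finZmodType) (S : {set G}) (x y : G) :
  step S x y = (y - x \in 0 |: S).
Proof. by rewrite /step /Cay !inE subr_eq0. Qed.

Lemma step_translate (G : finZmodType) (S T : {set G}) (u v x : G) :
  T \subset S -> step T u v -> step S x (x + (v - u)).
Proof.
move=> sTS; rewrite !stepE addrAC subrr add0r !inE.
by case/orP=> [->//|/(subsetP sTS)->]; rewrite orbT.
Qed.

Lemma moves_refl (G : finZmodType) (S : {set G}) (I : finType) :
  reflexive (@moves G S I).
Proof. by move=> c; apply/forallP => i; apply: step_refl. Qed.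

(** Strategies compose, with [P] as intermediate goal. The disjunction is needed because goals are
    tested with the robber to play. *)
Lemma force_bind (G : finZmodType) (S T : {set G}) (I : finType)
    (P Q : {ffun I -> G} -> G -> Prop) (c : {ffun I -> G}) (r : G) :
    (forall c r, P c r ->
       Q c r \/ forall r', step T r r' -> force S T Q c r') ->
  force S T P c r -> force S T Q c r.
Proof.
move=> PQ; elim=> {c r} [c r c' cc' /PQ[Qc' | Qc'] | c r c' cc' _ IH].
- exact: force_now cc' Qc'.
- exact: force_next cc' Qc'.
- exact: force_next cc' IH.
Qed.

(** * Forced capture and winning strategies *)

(** The strategy is read off the derivation of [force], by choosing one for each robber reply. *)
Lemma force_caught_strategy (G : finZmodType) (S T : {set G}) (m : nat)
    (c : {ffun 'I_m -> G}) (x : G) :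
    force S T (@caught G _) c x ->
  exists2 sigma : strategy G m, sigma [::] = c &
    forall r, robber_play T r -> r 0%N = x ->
      legal_against S sigma r /\ captures sigma r.
Proof.
elim=> {c x} [c x c' /forallP cc' [j c'jx] | c x c' /forallP cc' _ IH].
  exists (fun l => if l is [::] then c else c') => // r _ r0.
  split=> [[|i] j' /= | ]; [exact: cc' | exact: step_refl |].
  by exists 0%N, j; right; rewrite r0.
have /choice[sg sgP] : forall y, exists sigma : strategy G m, step T x y ->
    sigma [::] = c' /\ forall r, robber_play T r -> r 0%N = y ->
      legal_against S sigma r /\ captures sigma r.
  move=> y; case: (boolP (step T x y)) => [/IH[sigma s0 sP] | _].
    by exists sigma.
  by exists (fun=> c').
(* The strategy of the subgame sees the history without its first entry. On a one-entry history [c']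
   agrees with [sg y [::]] for every legal reply [y]. *)
pose sigma : strategy G m := fun l =>
  if l is _ :: l' then if l' is y :: _ then sg y l' else c' else c.
exists sigma => // r rP r0.
have mkS i : mkseq r i.+1 = r 0%N :: mkseq (fun k => r k.+1) i.
  by rewrite /mkseq /= (iotaDl 1 0) -map_comp.
have st : step T x (r 1%N) by rewrite -r0; apply: rP.
have [sg0 sg1] := sgP _ st.
have [leg cap] := sg1 (fun k => r k.+1) (fun i => rP i.+1) erefl.
have sgE i : sigma (mkseq r i.+1) = sg (r 1%N) (mkseq (fun k => r k.+1) i).
  by rewrite mkS; case: i.
have sigma0 : sigma [::] = c by [].
clearbody sigma; split=> [[|i] j | ].
- by rewrite sgE sigma0 sg0; apply: cc'.
- by rewrite !sgE; apply: leg.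
- by case: cap => i [j cap]; exists i.+1, j; rewrite !sgE.
Qed.

Lemma force_cops_win (G : finZmodType) (S T : {set G}) (m : nat)
    (c : {ffun 'I_m -> G}) :
  (forall x, force S T (@caught G _) c x) -> cops_win S T m.
Proof.
move=> cP.
have /choice[sg sgP] : forall x, exists sigma : strategy G m,
    sigma [::] = c /\ forall r, robber_play T r -> r 0%N = x ->
      legal_against S sigma r /\ captures sigma r.
  by move=> x; have [sigma] := force_caught_strategy (cP x); exists sigma.
pose sigma : strategy G m := fun l => if l is x :: _ then sg x l else c.
exists sigma => r rP.
have sgE i : sigma (mkseq r i) = sg (r 0%N) (mkseq r i).
  by case: i => //=; rewrite (sgP _).1.
clearbody sigma.
have [leg [i [j cap]]] := (sgP (r 0%N)).2 r rP erefl.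
split=> [i' j'|]; first by rewrite !sgE; apply: leg.
by exists i, j; rewrite !sgE.
Qed.

(* If the placement [sigma [::]] were not winning, the robber could keep the
   position unwinnable forever; the history is carried along so that this
   evasion is a single infinite play against [sigma]. *)
Lemma cops_win_force (G : finZmodType) (S T : {set G}) (m : nat) :
    cops_win S T m ->
  exists c : {ffun 'I_m -> G}, forall x, force S T (@caught G _) c x.
Proof.
case=> sigma sP; exists (sigma [::]) => x; apply: contrapT => nforce.
(* [hx] holds the past positions and the current one; [nxt] goes to a reply from which capture is
   not forced, if there is one, and otherwise stays. *)
have /choice[nxt nxtP] : forall hx : seq G * G, exists y, step T hx.2 y /\
    ((exists2 y, step T hx.2 y &
        ~ force S T (@caught G _) (sigma (rcons hx.1 hx.2)) y) ->
     ~ force S T (@caught G _) (sigma (rcons hx.1 hx.2)) y).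
  move=> hx; case: (pselect (exists2 y, step T hx.2 y &
        ~ force S T (@caught G _) (sigma (rcons hx.1 hx.2)) y)).
    by case=> y ? ?; exists y.
  by exists hx.2; split=> //; apply: step_refl.
pose st i := iter i (fun hx => (rcons hx.1 hx.2, nxt hx)) ([::], x).
pose r i := (st i).2.
have hE i : (st i).1 = mkseq r i.
  by elim: i => // i IH; rewrite mkseqS -IH.
have rP : robber_play T r by move=> i; apply: (nxtP (st i)).1.
have [leg [i [j cap]]] := sP _ rP.
have movesP k : moves S (sigma (mkseq r k)) (sigma (mkseq r k.+1)).
  by apply/forallP => j'; apply: leg.
have nf k : ~ force S T (@caught G _) (sigma (mkseq r k)) (r k).
  elim: k => // k IH.
  have := (nxtP (st k)).2; rewrite hE -/(r k) -mkseqS; apply.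
  apply: contrapT => nex; apply: IH; apply: force_next (movesP k) _ => y ry.
  by apply: contrapT => nfy; apply: nex; exists y.
(* A capture by the robber's own move becomes a forced one by letting all cops stay. *)
case: cap => cap; apply: (nf i).
  by apply: force_now (moves_refl _ _) _; exists j.
by apply: force_now (movesP i) _; exists j.
Qed.

(** * Walking the cops to any placement *)

(** The displacements achievable by steps from every vertex contain [S] and are closed under
    addition; as [G] is finite, they form a subgroup without any check of inverses. *)
Lemma gen_connect_step (G : finZmodType) (S : {set G}) :
  <<S>>%g = [set: G] -> forall u v, connect (step S) u v.
Proof.
move=> genS u v.
pose A := [set x : G | [forall w, connect (step S) w (w + x)]].
have gA : group_set A.
  apply/group_setP; split.
    by rewrite inE; apply/forallP => w; rewrite addr0.
  move=> x y; rewrite !inE => /forallP Ax /forallP Ay; apply/forallP => w.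
  by rewrite FinRing.zmodMgE addrA; apply: connect_trans (Ax w) (Ay _).
have : <<S>>%g \subset Group gA.
  rewrite gen_subG; apply/subsetP => x Sx; rewrite inE; apply/forallP => w.
  by apply: connect1; rewrite stepE [w + x]addrC addrK !inE Sx orbT.
rewrite genS => /subsetP/(_ (v - u)); rewrite !inE => /(_ isT)/forallP/(_ u).
by rewrite addrC subrK.
Qed.

Lemma connect_rev_ind (T : finType) (e : rel T) (P : T -> Prop) (y : T) :
    P y -> (forall x z, e x z -> P z -> P x) ->
  forall x, connect e x y -> P x.
Proof.
move=> Py Pe x /connectP[p]; elim: p x => [|z p IH] x /=; first by move=> _ <-.
by case/andP=> xz zp yE; apply: Pe xz _; apply: IH.
Qed.

Lemma connect_moves (G : finZmodType) (S : {set G}) (I : finType) :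
    (forall u v, connect (step S) u v) ->
  forall c d : {ffun I -> G}, connect (@moves G S I) c d.
Proof.
move=> conS c d.
(* The cops walk one at a time; those in [s] have arrived. *)
pose mix (s : seq I) := [ffun i => if i \in s then d i else c i].
have -> : d = mix (enum I) by apply/ffunP => i; rewrite ffunE mem_enum.
elim: (enum I) => [|i s IH].
  by rewrite (_ : mix [::] = c) //; apply/ffunP => i; rewrite ffunE.
apply: connect_trans IH _.
pose upd x := [ffun i' => if i' == i then x else mix s i'].
have -> : mix (i :: s) = upd (d i).
  by apply/ffunP => i'; rewrite !ffunE inE; case: eqP => // ->.
have -> : mix s = upd (mix s i).
  by apply/ffunP => i'; rewrite [RHS]ffunE; case: eqP => // ->.
pose P x := connect (@moves G S I) (upd x) (upd (d i)).
apply: (connect_rev_ind (P := P) _ _ (conS _ _)); first exact: connect0.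
move=> x z xz.
apply: connect_trans; apply: connect1; apply/forallP => i'; rewrite !ffunE.
by case: eqP => // _; apply: step_refl.
Qed.

(** The cops may ignore the robber while walking to [d], since [d] is good against every robber
    position. *)
Lemma force_connect (G : finZmodType) (S T : {set G}) (I : finType)
    (P : {ffun I -> G} -> G -> Prop) (c d : {ffun I -> G}) :
    connect (@moves G S I) c d -> (forall r, force S T P d r) ->
  forall r, force S T P c r.
Proof.
move=> cd dP; move: c cd; apply: connect_rev_ind dP _ => c c' cc' IH r.
by apply: force_next cc' _ => r' _.
Qed.

(** * Cop numbers: the one-cop cases, and the chase along multiples of [k] *)

Lemma cop_number_le (G : finZmodType) (S T : {set G}) (m : nat) :
  cops_win S T m -> (cop_number S T <= m)%N.
Proof. by rewrite /cop_number; case: ex_minnP => k _ + /asboolP; apply. Qed.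

Lemma cop_number_win (G : finZmodType) (S T : {set G}) :
  cops_win S T (cop_number S T).
Proof. by rewrite /cop_number; case: ex_minnP => k /asboolP. Qed.

Lemma cop_number_set0 (G : finZmodType) (S : {set G}) :
  <<S>>%g = [set: G] -> (cop_number S set0 <= 1)%N.
Proof.
move=> genS; apply: cop_number_le.
apply: (@force_cops_win _ _ _ _ [ffun=> 0]) => x.
have con := connect_moves (gen_connect_step genS)
  [ffun=> 0] [ffun _ : 'I_1 => x].
pose P c := force S set0 (@caught G 'I_1) c x.
apply: (connect_rev_ind (P := P) _ _ con).
  by apply: force_now (moves_refl _ _) _; exists ord0; rewrite ffunE.
move=> c d cd dx; apply: force_next cd _ => x'.
by rewrite /step /Cay inE orbF => /eqP->.
Qed.

Lemma cop_number_full (G : finZmodType) (S T : {set G}) :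
  0 \notin S -> #|S| = (#|G| - 1)%N -> (cop_number S T <= 1)%N.
Proof.
move=> S0 cardS; apply: cop_number_le.
apply: (@force_cops_win _ _ _ _ [ffun=> 0]) => x.
apply: (@force_now _ _ _ _ _ _ _ [ffun=> x]); last first.
  by exists ord0; rewrite ffunE.
have fullS : 0 |: S = [set: G].
  apply/eqP; rewrite eqEcard subsetT /= cardsU1 S0 cardS cardsT.
  by rewrite subnKC //; apply/card_gt0P; exists 0.
by apply/forallP => i; rewrite stepE fullS inE.
Qed.

(* The cop [i0], at distance [k *+ N] from the robber, answers each move [a]
   by [a] itself or, when [k] accounts for it, by [a - k].  Accounted moves
   thus decrease [N]; while the robber avoids them, the other cops play their
   winning game against the unaccounted moves, restarting it from scratch after
   each accounted move. *)
Lemma force_chaser (G : finZmodType) (S T : {set G}) (k : G)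
    (I J : finType) (f : J -> I) (i0 : I) (d0 : {ffun J -> G}) :
    <<S>>%g = [set: G] -> T \subset S -> injective f -> (forall j, f j != i0) ->
    (forall r, force S [set a in T | ~~ accounts S k a] (@caught G J) d0 r) ->
  forall (N : nat) (c : {ffun I -> G}) (r : G), c i0 - r = k *+ N ->
  caught c r \/ forall r', step T r r' -> force S T (@caught G I) c r'.
Proof.
set T'' := [set a in T | _] => genS sTS injf fi0 d0P.
have dP d r : force S T'' (@caught G J) d r.
  by apply: force_connect d0P r; apply/connect_moves/gen_connect_step.
elim=> [|N IHN] c r cr.
  by left; exists i0; apply/eqP; rewrite -subr_eq0 cr mulr0n.
right.
(* Reply to an accounted move [a]: the chaser moves by [a - k], which lies in [0 |: S], and the
   others stay. *)
have answer y r' (e : {ffun I -> G}) : e i0 - y = k *+ N.+1 ->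
    step T y r' -> ~~ step T'' y r' -> force S T (@caught G I) e r'.
  move=> ey; rewrite !stepE !inE; case: eqP => //= _ Ta.
  rewrite Ta negbK => acc.
  pose e' := [ffun i => if i == i0 then e i0 + (r' - y) - k else e i].
  have ee' : moves S e e'.
    apply/forallP => i; rewrite ffunE.
    case: eqP => [->|_]; last exact: step_refl.
    case/exists_inP: acc => b Sb /eqP <-.
    by rewrite stepE opprB addrACA subrr addr0 addrAC subrr add0r.
  have /IHN : e' i0 - r' = k *+ N.
    rewrite ffunE eqxx -[k *+ N](addrK k) -mulrSr -ey.
    by rewrite addrAC addrA (addrAC _ (- y)) addrK.
  by case=> e'r'; [apply: force_now ee' _ | apply: force_next ee' _].
(* Here [x] is the chaser's pending reply to the robber's last move, made in the same turn as the
   subteam's move. *)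
have play d r1 : force S T'' (@caught G J) d r1 ->
    forall e : {ffun I -> G}, (forall j, e (f j) = d j) ->
    forall x, step S (e i0) x -> x - r1 = k *+ N.+1 ->
    force S T (@caught G I) e r1.
  (* The subteam goes to [d], the chaser to [x], and any other cop stays. *)
  pose ext (e : {ffun I -> G}) (d : {ffun J -> G}) x := [ffun i =>
    if [pick j | f j == i] is Some j then d j else if i == i0 then x else e i].
  have extf e d' x j : ext e d' x (f j) = d' j.
    rewrite ffunE; case: pickP => [j' /eqP/injf -> // | /(_ j)].
    by rewrite eqxx.
  have exti0 e d' x : ext e d' x i0 = x.
    rewrite ffunE eqxx; case: pickP => // j.
    by rewrite (negPf (fi0 j)).
  have extP (e : {ffun I -> G}) (d1 d' : {ffun J -> G}) x :
      (forall j, e (f j) = d1 j) -> moves S d1 d' ->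
      step S (e i0) x -> moves S e (ext e d' x).
    move=> ed /forallP dd' ex; apply/forallP => i; rewrite ffunE.
    case: pickP => [j /eqP <-|_]; first by rewrite ed.
    by case: eqP => [->|_] //; apply: step_refl.
  elim=> {d r1} [d r1 d' dd' [j d'j] | d r1 d' dd' _ IH] e ed x ex xr.
    by apply: force_now (extP _ _ _ _ ed dd' ex) _; exists (f j); rewrite extf.
  apply: force_next (extP _ _ _ _ ed dd' ex) _ => r' rr'.
  case: (boolP (step T'' r1 r')) => [rr''|nrr'']; last first.
    by apply: answer rr' nrr''; rewrite exti0.
  apply: (IH _ rr'' _ (extf _ _ _) (x + (r' - r1))).
    by rewrite exti0; apply: step_translate rr'.
  by rewrite addrA addrAC addrK.
move=> r' rr'; case: (boolP (step T'' r r')) => [rr''|]; last exact: answer.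
apply: (play [ffun j => c (f j)] _ (dP _ _) _ _ (c i0 + (r' - r))).
- by move=> j; rewrite ffunE.
- exact: step_translate rr'.
- by rewrite addrA addrAC addrK.
Qed.

(** * Passing to the quotient by a cyclic subgroup *)

(** Robber moves project to steps, those in the kernel to staying; cop moves lift, a zero
    displacement to staying. Capture downstairs only means sharing a fibre upstairs. *)
Lemma force_lift (G Q : finZmodType) (S T : {set G}) (pi : {additive G -> Q})
    (I : finType) (d : {ffun I -> Q}) (q : Q) :
    force (pi @: S :\ 0) (pi @: T :\ 0) (@caught Q I) d q ->
  forall (c : {ffun I -> G}) (r : G), (forall i, pi (c i) = d i) -> pi r = q ->
  force S T (fun c r => exists i, pi (c i) = pi r) c r.
Proof.
have lift (d1 d' : {ffun I -> Q}) (c : {ffun I -> G}) :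
    moves (pi @: S :\ 0) d1 d' -> (forall i, pi (c i) = d1 i) ->
    exists2 c', moves S c c' & forall i, pi (c' i) = d' i.
  move=> /forallP dd' cd.
  have /choice[c' c'P] : forall i, exists y, step S (c i) y /\ pi y = d' i.
    move=> i; have := dd' i; rewrite stepE !inE.
    case: eqP => /= [/eqP|_ /imsetP[a Sa aE]].
      by rewrite subr_eq0 => /eqP-> _; exists (c i); rewrite cd step_refl.
    exists (c i + a); rewrite stepE addrAC subrr add0r !inE Sa orbT.
    by rewrite raddfD cd -aE addrC subrK.
  exists [ffun i => c' i] => [|i]; last by rewrite ffunE (c'P i).2.
  by apply/forallP => i; rewrite ffunE (c'P i).1.
elim=> {d q} [d q d' /lift dd' [i d'i] | d q d' /lift dd' _ IH] c r cd rq;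
  have [c' cc' c'd'] := dd' _ cd.
  by apply: force_now cc' _; exists i; rewrite c'd' d'i.
apply: force_next cc' _ => r' rr'; apply: IH c'd' erefl.
move: rr'; rewrite !stepE -rq -raddfB !inE => /orP[/eqP->|Ta].
  by rewrite raddf0 eqxx.
by case: eqP => //= _; apply: imset_f.
Qed.

Lemma mem_norm_zmod (G : finZmodType) (A : {set G}) (x : G) : x \in 'N(A)%g.
Proof.
have abG := FinRing.zmod_abelian [set: G].
by apply: (subsetP (sub_abelian_norm abG (subsetT A))).
Qed.

(** A separate name for the quotient group, on which multiplication of cosets is reread as
    addition. *)
Definition cycle_quotient (G : finZmodType) (k : G) := coset_of <[k]>%g.

HB.instance Definition _ (G : finZmodType) (k : G) :=
  Finite.copy (cycle_quotient k) (coset_of <[k]>%g).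

Fact cycle_quotient_mulC (G : finZmodType) (k : G) :
  commutative (fun x y : coset_of <[k]>%g => (x * y)%g).
Proof.
move=> x y; case: (cosetP x) => a _ ->; case: (cosetP y) => b _ ->.
by rewrite -!coset_morphM ?mem_norm_zmod // !FinRing.zmodMgE addrC.
Qed.

HB.instance Definition _ (G : finZmodType) (k : G) :=
  GRing.isZmodule.Build (cycle_quotient k)
    (@mulgA (coset_of <[k]>%g)) (@cycle_quotient_mulC G k)
    (@mul1g (coset_of <[k]>%g)) (@mulVg (coset_of <[k]>%g)).

Lemma cycle_quotientP (G : finZmodType) (k : G) :
  exists (Q : finZmodType) (pi : {additive G -> Q}),
    [/\ forall q, exists x, pi x = q, forall x, pi x = 0 -> x \in <[k]>%g
      & (#|Q| * #[k]%g)%N = #|G|].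
Proof.
pose pi (x : G) : cycle_quotient k := coset <[k]>%g x.
have piB : {morph pi : x y / x - y}.
  move=> x y; rewrite /pi -FinRing.zmodVgE -FinRing.zmodMgE.
  rewrite coset_morphM ?mem_norm_zmod //.
  by rewrite (morphV (coset_morphism <[k]>%g)) ?mem_norm_zmod.
pose piM := GRing.isZmodMorphism.Build _ _ pi piB.
pose piA : {additive G -> cycle_quotient k} := HB.pack pi piM.
exists (cycle_quotient k), piA; split.
- by move=> q; exists (repr (q : coset_of _)); apply: coset_reprK.
- by move=> x x0; apply: coset_idr => //; apply: mem_norm_zmod.
- have sTN : [set: G] \subset ('N(<[k]>))%g.
    by apply/subsetP => x _; apply: mem_norm_zmod.
  rewrite -[#|G|]cardsT -(Lagrange (subsetT <[k]>%g)) mulnC.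
  by rewrite -card_quotient // quotientT cardsT.
Qed.

(** The preimage of the subgroup generated by the image is a subgroup containing [S]; deleting 0
    from the image does not change what it generates. *)
Lemma Gd_image (G Q : finZmodType) (pi : {additive G -> Q}) (S T : {set G}) :
    (forall q, exists x, pi x = q) -> Gd S T ->
  Gd (pi @: S :\ 0) (pi @: T :\ 0).
Proof.
move=> surj [genS S0 sTS]; split; last 2 first.
- by rewrite !inE eqxx.
- by apply/setSD/imsetS.
apply/eqP; rewrite eqEsubset subsetT /=; apply/subsetP => q _.
have [x <-] := surj q.
pose A := [set y | pi y \in <<pi @: S :\ 0>>%g].
have gA : group_set A.
  apply/group_setP; split; first by rewrite inE raddf0 (group1 <<_>>%G).
  by move=> y z; rewrite !inE FinRing.zmodMgE raddfD; apply: groupM.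
suff : <<S>>%g \subset Group gA.
  by rewrite genS => /subsetP/(_ x); rewrite !inE; apply.
rewrite gen_subG; apply/subsetP => y Sy; rewrite inE.
have [->|y0] := eqVneq (pi y) 0; first exact: (group1 <<_>>%G).
by apply: mem_gen; rewrite !inE y0 imset_f.
Qed.

Lemma Gu_image (G Q : finZmodType) (pi : {additive G -> Q}) (S T : {set G}) :
    (forall q, exists x, pi x = q) -> Gu S T ->
  Gu (pi @: S :\ 0) (pi @: T :\ 0).
Proof.
move=> surj [/(Gd_image surj) ST' SN]; split=> //.
have SN' y : y \in S -> - y \in S by move=> Sy; rewrite SN imset_f.
have sub q : q \in pi @: S :\ 0 -> - q \in pi @: S :\ 0.
  rewrite !inE oppr_eq0 => /andP[-> /imsetP[y /SN' Sy ->]] /=.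
  by rewrite -raddfN imset_f.
apply/setP => q; apply/idP/imsetP => [/sub Sq | [q' /sub Sq' ->] //].
by exists (- q); rewrite ?opprK.
Qed.

Lemma cops_win_leq (G : finZmodType) (S T : {set G}) (m m' : nat) :
  (m <= m')%N -> cops_win S T m -> cops_win S T m'.
Proof.
move=> lemm' [sigma sP].
(* The extra cops are parked at 0. *)
pose sigma' : strategy G m' := fun l => [ffun j : 'I_m' =>
  if insub (val j) is Some j' then sigma l j' else 0 : G].
exists sigma' => r /sP[leg [i [j cap]]]; split.
  move=> i' j'; rewrite !ffunE; case: insub => [j''|]; first exact: leg.
  exact: step_refl.
by exists i, (widen_ord lemm' j); rewrite !ffunE /= valK.
Qed.

(** * The recursive bound on the cop number *)

Lemma cop_number_image (G Q : finZmodType) (pi : {additive G -> Q}) (k : G)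
    (S T : {set G}) :
    (forall q, exists x, pi x = q) -> (forall x, pi x = 0 -> x \in <[k]>%g) ->
    Gd S T ->
  (cop_number S T <= maxn (cop_number (pi @: S :\ 0%R) (pi @: T :\ 0%R))
     (cop_number S [set a in T | ~~ accounts S k a]).+1)%N.
Proof.
move=> surj kerpi [genS S0 sTS]; set m := maxn _ _; apply: cop_number_le.
have [m' mE] : exists m', m = m'.+1.
  by exists m.-1; rewrite prednK // leq_max orbT.
have [d dP] : exists d : {ffun 'I_m -> Q}, forall q,
    force (pi @: S :\ 0) (pi @: T :\ 0) (@caught Q _) d q.
  by apply/cops_win_force/(cops_win_leq _ (cop_number_win _ _))/leq_maxl.
have [e eP] : exists e : {ffun 'I_m' -> G}, forall r,
    force S [set a in T | ~~ accounts S k a] (@caught G _) e r.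
  apply/cops_win_force/(cops_win_leq _ (cop_number_win _ _)).
  by rewrite -ltnS -mE leq_maxr.
move: m mE d dP => _ -> d dP.
have /choice[c cP] : forall i, exists x, pi x = d i by move=> i; apply: surj.
apply: (@force_cops_win _ _ _ _ [ffun i => c i]) => r.
have := force_lift (dP (pi r)) (c := [ffun i => c i]) (r := r).
have cd i : pi ([ffun i => c i] i) = d i by rewrite ffunE cP.
move=> /(_ cd erefl); apply: force_bind => c' r' [i c'i].
have /kerpi/cycleP[N c'r'] : pi (c' i - r') = 0 by rewrite raddfB c'i subrr.
(* Whichever cop [i] reached the robber's coset becomes the chaser; [lift i] enumerates the
   remaining [m']. *)
apply: (force_chaser genS sTS (@lift_inj _ i) _ eP c'r') => j.
by rewrite eq_sym neq_lift.
Qed.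

(** * Maxima over a class, and the double induction *)

Lemma max_cop_number_ge (C : triple_class) (G : finZmodType) (S T : {set G}) :
  C G S T -> (cop_number S T <= max_cop_number C #|G| #|S| #|T|)%N.
Proof.
move=> CST; rewrite /max_cop_number.
have att : `[< attained C #|G| #|S| #|T| (cop_number S T) >].
  by apply/asboolP; exists G, S, T.
case: pselect => [ex|[]]; last by exists (cop_number S T).
by case: ex_maxnP => k _; apply.
Qed.

(** The assumption [1 <= b] covers the default value when no triple exists. *)
Lemma max_cop_number_le (R : realType) (C : triple_class) (n s t : nat)
    (b : R) :
    1 <= b ->
    (forall (G : finZmodType) (S T : {set G}), C G S T ->
       #|G| = n -> #|S| = s -> #|T| = t -> (cop_number S T)%:R <= b) ->
  (max_cop_number C n s t)%:R <= b.
Proof.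
move=> b1 bP; rewrite /max_cop_number; case: pselect => [ex|//].
case: ex_maxnP => k /asboolP[G [S [T [CST Gn Ss Tt <-]]]] _.
exact: bP CST Gn Ss Tt.
Qed.

Lemma Gd_inD (G : finZmodType) (S T : {set G}) :
  Gd S T -> inD #|G| #|S| #|T|.
Proof.
case=> _ S0 sTS; rewrite /inD subset_leq_card // andbT.
have G0 : (0 < #|G|)%N by apply/card_gt0P; exists 0.
rewrite G0 /= -ltnS subn1 prednK // -cardsT; apply: proper_card.
by apply/properP; split; [exact: subsetT | exists 0; rewrite ?inE].
Qed.

(** A quotient triple may fall into the excluded set, where the hypotheses on [g] say nothing. *)
Lemma cop_number_inB (G : finZmodType) (S T : {set G}) :
  Gd S T -> inB #|G| #|S| #|T| -> (cop_number S T <= 1)%N.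
Proof.
move=> [genS S0 _] /andP[_ /orP[|/eqP]]; last exact: cop_number_full.
by rewrite cards_eq0 => /eqP->; apply: cop_number_set0.
Qed.

Unset Implicit Arguments.

Theorem lemma2p8 (R : realType)
    (C : triple_class) (c : nat -> nat -> nat -> nat)
    (hCc : (C = Gd /\ c = cd) \/ (C = Gu /\ c = cu))
    (g h : nat -> nat -> nat -> R)
    (hg : forall n s t : nat, inD n s t -> ~~ inB n s t -> 2 <= g n s t)
    (hh : forall n s t : nat, inD n s t -> ~~ inB n s t -> 0 < h n s t)
    (h1 : forall n s t : nat, inD n s t -> ~~ inB n s t ->
       forall (G : finZmodType) (S T : {set G}),
         C G S T -> #|G| = n -> #|S| = s -> #|T| = t ->
         exists k : G, k != 0 /\
           h n s t <= #|[set a in T | accounts S k a]|%:R)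
    (h2 : forall n s t : nat, inD n s t -> ~~ inB n s t ->
       forall n' s' t' : nat, inD n' s' t' -> ~~ inB n' s' t' ->
         n'%:R <= n%:R / 2 :> R -> (s' <= s)%N -> (t' <= t)%N ->
         (c n' s' t')%:R <= g n s t \/ g n' s' t' <= g n s t)
    (h3 : forall n s t : nat, inD n s t -> ~~ inB n s t ->
       forall t' : nat, (1 <= t')%N -> t'%:R <= t%:R - h n s t ->
         g n s t' + 1 <= g n s t) :
  forall n s t : nat, inD n s t -> ~~ inB n s t -> (c n s t)%:R <= g n s t.
Proof.
have cE : c = max_cop_number C by case: hCc => -[-> ->].
(* Both classes are treated at once through three facts: inclusion in [Gd], and closure under
   shrinking [T] and under surjective images. *)
have CGd (G : finZmodType) (S T : {set G}) : C G S T -> Gd S T.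
  by case: hCc => -[-> _] // [].
have Csub (G : finZmodType) (S T T' : {set G}) :
    C G S T -> T' \subset T -> C G S T'.
  have GdS (dST : Gd S T) (sT : T' \subset T) : Gd S T'.
    by have [? ? sTS] := dST; split=> //; apply: subset_trans sTS.
  by case: hCc => -[-> _]; [exact: GdS | case=> /GdS GdT' SN /GdT'].
have Cimage (G Q : finZmodType) (pi : {additive G -> Q}) (S T : {set G}) :
    (forall q, exists x, pi x = q) -> C G S T ->
    C Q (pi @: S :\ 0) (pi @: T :\ 0).
  by case: hCc => -[-> _]; [apply: Gd_image | apply: Gu_image].
(* The outer induction on [n] serves the quotient, the inner one on [t] the smaller moveset
   [T'']. *)
move=> n; have [N] := ubnP n; elim: N n => // N IHn n ltnN s t.
have [M] := ubnP t; elim: M t => // M IHt t lttM Dnst Bnst.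
have g2 := hg _ _ _ Dnst Bnst.
rewrite cE; apply: max_cop_number_le.
  by apply: le_trans g2; rewrite ler1n.
move=> G S T CST Gn Ss Tt.
have [k [k0 hk]] := h1 _ _ _ Dnst Bnst _ _ _ CST Gn Ss Tt.
have [Q [pi [surj kerpi cardQ]]] := cycle_quotientP k.
have CQ := Cimage _ _ pi _ _ surj CST.
set S' := pi @: S :\ 0 in CQ; set T' := pi @: T :\ 0 in CQ.
set T'' := [set a in T | ~~ accounts S k a].
have sT''T : T'' \subset T by apply/subsetP => a; rewrite inE => /andP[].
have CT'' := Csub _ _ _ _ CST sT''T.
have := cop_number_image surj kerpi (CGd _ _ _ CST).
rewrite -/S' -/T' -/T'' -(ler_nat R) => /le_trans; apply.
suff : (cop_number S' T')%:R <= g n s t /\ (cop_number S T'').+1%:R <= g n s t.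
  by rewrite /maxn; case: ifP => _ [].
split.
  case: (boolP (inB #|Q| #|S'| #|T'|)) => [BQ | nBQ].
    apply: le_trans g2; rewrite ler_nat.
    by rewrite (leq_trans (cop_number_inB (CGd _ _ _ CQ) BQ)).
  (* As [k] is nonzero, the quotient has at most half the order of [G]. *)
  have k_gt1 : (1 < #[k]%g)%N by rewrite order_gt1.
  have Q0 : (0 < #|Q|)%N by apply/card_gt0P; exists 0.
  have QG : (#|Q| * 2 <= n)%N by rewrite -Gn -cardQ leq_mul2l k_gt1 orbT.
  have cQ : (cop_number S' T')%:R <= (c #|Q| #|S'| #|T'|)%:R :> R.
    by rewrite ler_nat cE; apply: max_cop_number_ge.
  have card_img (A : {set G}) : (#|pi @: A :\ 0%R| <= #|A|)%N.
    exact: leq_trans (subset_leq_card (subsetDl _ _)) (leq_imset_card _ _).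
  have DQ := Gd_inD (CGd _ _ _ CQ).
  case: (h2 _ _ _ Dnst Bnst _ _ _ DQ nBQ).
  - by rewrite ler_pdivlMr ?ltr0n // -natrM ler_nat.
  - by rewrite -Ss; apply: card_img.
  - by rewrite -Tt; apply: card_img.
  - exact: le_trans cQ.
  apply: le_trans; apply: le_trans cQ _; apply: IHn => //.
  rewrite -ltnS; apply: leq_trans ltnN; rewrite ltnS.
  by apply: leq_trans QG; rewrite muln2 -addnn -[X in (X < _)%N]addn0 ltn_add2l.
have TE : (#|[set a in T | accounts S k a]| + #|T''|)%N = t.
  rewrite -Tt -(cardsID [set a | accounts S k a] T); congr (_ + _)%N;
  by apply: eq_card => a; rewrite !inE // andbC.
(* With every move accounted for, [h3] does not apply, but one further cop besides the chaser is
   enough, and [g] is at least 2. *)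
have [T''0|T''0] := eqVneq #|T''| 0%N.
  apply: le_trans g2; rewrite ler_nat ltnS.
  move/eqP: T''0; rewrite cards_eq0 => /eqP->.
  by apply: cop_number_set0; case: (CGd _ _ _ CST).
have D'' : inD n s #|T''| by rewrite -Gn -Ss; apply: Gd_inD (CGd _ _ _ CT'').
have B'' : ~~ inB n s #|T''|.
  move: Bnst; rewrite /inB Dnst D'' (negPf T''0) /=; apply: contra => ->.
  by rewrite orbT.
have h0 := hh _ _ _ Dnst Bnst.
(* Positivity of [h] makes [T''] strictly smaller than [T], as the inner induction requires. *)
have acc0 : (0 < #|[set a in T | accounts S k a]|)%N.
  by rewrite -(ltr_nat R); apply: lt_le_trans hk.
(* The [+ 1] in [h3] pays for the chaser. *)
rewrite -natr1; apply: le_trans (h3 _ _ _ Dnst Bnst #|T''| _ _).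
- rewrite lerD2r; apply: le_trans (IHt _ _ D'' B'').
    by rewrite ler_nat cE -Gn -Ss; apply: max_cop_number_ge.
  apply: leq_trans (lttM : (t <= M)%N).
  by rewrite -TE -[X in (X < _)%N]add0n ltn_add2r.
- by rewrite lt0n.
- by rewrite lerBrDl -[X in _ <= X%:R]TE natrD lerD2r.
Qed.
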